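(* Let $\Gamma$ be the sub-algebra of $M_2(\mathbb{C})[z]$ consisting of the polynomials of the form $$\begin{pmatrix} a&0\\ b-a&b\end{pmatrix}+\begin{pmatrix} c&c\\ a-b-c&-c\end{pmatrix}z+\begin{pmatrix} a-b-c&c+a-b\\ d&e\end{pmatrix}\frac{z^2}{2}+z^3p(z),$$ where $p\in M_2(\mathbb{C})[z]$ and all the variables $a,b,c,d,e\in\mathbb{C}$ are arbitrary. Then $\Gamma=\mathbb{A}$.
   Context: Let $$\psi(x,z)=\frac{e^{xz}}{(x-2)xz}\begin{pmatrix}\dfrac{x^3z^2-2x^2z^2-2x^2z+3xz+2x-2}{xz}&\dfrac1x\\[2mm] \dfrac{xz-2}{z}&x^2z-2xz-x+1\end{pmatrix}.$$ $\mathbb{A}$ is the algebra of all polynomials $F\in M_2(\mathbb{C})[z]$ for which there exists a linear differential operator $\mathcal{L}=\mathcal{L}(x,\partial_x)=\sum_{i=0}^{l}a_i(x)\partial_x^i$, acting from the left, with $2\times2$ matrix valued meromorphic coefficients $a_i$ (on a suitable nonempty connected open subset of $\mathbb{C}$), such that $\mathcal{L}\psi(x,z)=\psi(x,z)F(z)$. *)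

(* Defs.v *)
From mathcomp Require Import all_boot all_order all_algebra complex.
From mathcomp Require Import all_classical all_reals all_analysis.
From mathcomp Require Import ring.

Set Implicit Arguments.
Unset Strict Implicit.
Unset Printing Implicit Defensive.

Import Order.TTheory GRing.Theory Num.Theory.
Import numFieldNormedType.Exports.

Local Open Scope classical_set_scope.
Local Open Scope ring_scope.
Local Open Scope complex_scope.

(* The complex numbers over R.  Typing the alias as a [numFieldType] gives it
   the topology and the complex derivatives of MathComp-Analysis, where
   [derivable f x 1] is complex differentiability at [x]. *)
Definition Cplx (R : realType) : numFieldType := R[i].

Definition expC (R : realType) (w : Cplx R) : Cplx R :=
  (expR (complex.Re w))%:C *
  (cos (complex.Im w) +i* sin (complex.Im w)).

Definition mx22 (T : Type) (a b c d : T) : 'M[T]_2 :=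
  \matrix_(i < 2, j < 2)
    if i == 0%N :> nat then (if j == 0%N :> nat then a else b)
    else (if j == 0%N :> nat then c else d).

Lemma mx22D (K : pzRingType) (a b c d a' b' c' d' : K) :
  mx22 a b c d + mx22 a' b' c' d' = mx22 (a + a') (b + b') (c + c') (d + d').
Proof. by apply/matrixP => i j; rewrite !mxE; do 2?case: ifP. Qed.

Lemma mx22Z (K : pzRingType) (k a b c d : K) :
  k *: mx22 a b c d = mx22 (k * a) (k * b) (k * c) (k * d).
Proof. by apply/matrixP => i j; rewrite !mxE; do 2?case: ifP. Qed.

Lemma mx22M (K : nzRingType) (a b c d a' b' c' d' : K) :
  mx22 a b c d * mx22 a' b' c' d' =
  mx22 (a * a' + b * c') (a * b' + b * d') (c * a' + d * c') (c * b' + d * d').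
Proof.
apply/matrixP => i j; rewrite !mxE !big_ord_recl big_ord0 !mxE /= addr0.
by do 2?case: ifP.
Qed.

Lemma mx22_scalar (K : pzRingType) (k : K) : k%:M = mx22 k 0 0 k.
Proof.
by apply/matrixP => -[[|[|//]] ?] -[[|[|//]] ?]; rewrite !mxE.
Qed.

Section Meromorphic.
Variable K : numFieldType.

Definition holomorphic_at (f : K -> K) (x0 : K) : Prop :=
  \forall x \near x0, derivable f x 1.

(* A meromorphic function is represented by a total function whose values at
   isolated points, in particular at its poles, are irrelevant. *)
Definition meromorphic_at (f : K -> K) (x0 : K) : Prop :=
  exists (n : nat) (g : K -> K),
    holomorphic_at g x0 /\
    \forall x \near x0^', (x - x0) ^+ n * f x = g x.

Definition mx_holomorphic_at m n (f : K -> 'M[K]_(m, n)) (x0 : K) : Prop :=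
  forall i j, holomorphic_at (fun x => f x i j) x0.

Definition mx_meromorphic_on m n (U : set K) (f : K -> 'M[K]_(m, n)) : Prop :=
  forall x0, U x0 -> forall i j, meromorphic_at (fun x => f x i j) x0.

Definition mx_derive1n m n (k : nat) (f : K -> 'M[K]_(m, n)) (x : K) :
    'M[K]_(m, n) :=
  \matrix_(i, j) derive1n k (fun y => f y i j) x.

Definition diffop_apply m n (l : nat) (a : 'I_l.+1 -> K -> 'M[K]_m)
    (f : K -> 'M[K]_(m, n)) (x : K) : 'M[K]_(m, n) :=
  \sum_(i < l.+1) a i x *m mx_derive1n i f x.

End Meromorphic.

Section Bispectral.
Variable R : realType.
Local Notation C := (Cplx R).

Definition psi (x z : C) : 'M[C]_2 :=
  (expC (x * z) / ((x - 2) * x * z)) *: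
  mx22
    ((x ^+ 3 * z ^+ 2 - 2 * x ^+ 2 * z ^+ 2 - 2 * x ^+ 2 * z
        + 3 * x * z + 2 * x - 2) / (x * z))
    (x^-1)
    ((x * z - 2) / z)
    (x ^+ 2 * z - 2 * x * z - x + 1).

(* The identity L psi = psi F is one between meromorphic functions of x in U:
   it is required wherever psi is defined (x <> 0, 2 and z <> 0) and all the
   coefficients of L are holomorphic.  F(z) is the evaluation of F at the
   scalar matrix z. *)
Definition bispectral_algebra : set {poly 'M[C]_2} :=
  [set F | exists (U : set C) (l : nat) (a : 'I_l.+1 -> C -> 'M[C]_2),
    [/\ open U, U !=set0, connected U,
        (forall i, mx_meromorphic_on U (a i)) &
        forall x z : C, U x -> (forall i, mx_holomorphic_at (a i) x) ->
          x != 0 -> x != 2 -> z != 0 ->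
          diffop_apply a (fun y => psi y z) x = psi x z *m F.[z%:M]]].

Definition Gamma : set {poly 'M[C]_2} :=
  [set F | exists (a b c d e : C) (p : {poly 'M[C]_2}),
    F = (mx22 a 0 (b - a) b)%:P
      + (mx22 c c (a - b - c) (- c))%:P * 'X
      + (2^-1 *: mx22 (a - b - c) (c + a - b) d e)%:P * 'X^2
      + 'X^3 * p].

Lemma GammaP (F : {poly 'M[C]_2}) :
  Gamma F <-> exists a b c d e : C,
    [/\ F`_0 = mx22 a 0 (b - a) b, F`_1 = mx22 c c (a - b - c) (- c) &
        F`_2 = 2^-1 *: mx22 (a - b - c) (c + a - b) d e].
Proof.
split=> [[a [b [c [d [e [p ->]]]]]]|[a [b [c [d [e [F0 F1 F2]]]]]]].
  exists a, b, c, d, e.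
  by split; rewrite !coefD !coefCM coefXnM coefC coefX coefXn /=
                    ?mulr0 ?mulr1 ?addr0 ?add0r.
exists a, b, c, d, e, (drop_poly 3 F).
rewrite -F0 -F1 -F2 -commr_polyXn -{1}(poly_take_drop 3 F); congr (_ + _).
apply/polyP => i; rewrite coef_take_poly !coefD !coefCM coefC coefX coefXn.
by case: i => [|[|[|i]]] /=; rewrite ?mulr0 ?mulr1 ?addr0 ?add0r.
Qed.

(* The scalar k acts on polynomials through the scalar matrix k. *)
Lemma Gamma_subalgebra :
  [/\ Gamma 1,
      forall F G, Gamma F -> Gamma G -> Gamma (F + G),
      forall (k : C) F, Gamma F -> Gamma (k%:M *: F) &
      forall F G, Gamma F -> Gamma G -> Gamma (F * G)].
Proof.
split.
- apply/GammaP; exists 1, 1, 0, 0, 0; rewrite !coef1 mulr0n mulr1n mx22Z.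
  have -> : 1 = mx22 1 0 0 1 :> 'M[C]_2 by rewrite -mx22_scalar.
  have -> : 0 = mx22 0 0 0 0 :> 'M[C]_2 by rewrite -mx22_scalar raddf0.
  by split; congr mx22; ring.
- move=> F G /GammaP[a [b [c [d [e [F0 F1 F2]]]]]].
  move=> /GammaP[a' [b' [c' [d' [e' [G0 G1 G2]]]]]].
  apply/GammaP; exists (a + a'), (b + b'), (c + c'), (d + d'), (e + e').
  rewrite !coefD F0 F1 F2 G0 G1 G2 !mx22Z !mx22D.
  by split; congr mx22; ring.
- move=> k F /GammaP[a [b [c [d [e [F0 F1 F2]]]]]].
  apply/GammaP; exists (k * a), (k * b), (k * c), (k * d), (k * e).
  rewrite !coefZ F0 F1 F2 mx22_scalar !mx22Z !mx22M.
  by split; congr mx22; ring.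
- move=> F G /GammaP[a [b [c [d [e [F0 F1 F2]]]]]].
  move=> /GammaP[a' [b' [c' [d' [e' [G0 G1 G2]]]]]].
  apply/GammaP; exists (a * a'), (b * b'), (a * c' + c * b'),
    ((b - a) * (a' - b' - c') + b * d' + 2 * (a - b - c) * c'
       - 2 * c * (a' - b' - c') + d * a' + e * (b' - a')),
    (b * e' + (b - a) * (c' + a' - b') + 2 * (a - b - c) * c'
       + 2 * c * c' + e * b').
  rewrite !coefM !big_ord_recl !big_ord0 /= /bump /= F0 F1 F2 G0 G1 G2 !addr0.
  rewrite !mx22Z !mx22M !mx22D.
  by split; congr mx22; field.
Qed.

End Bispectral.

Arguments psi : clear implicits.
Arguments bispectral_algebra : clear implicits.
Arguments Gamma : clear implicits.

(* Main.v *)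
Require Import Defs.
From mathcomp Require Import all_boot all_order all_algebra complex.
From mathcomp Require Import all_classical all_reals all_analysis.
From mathcomp Require Import ring lra.

Set Implicit Arguments.
Unset Strict Implicit.
Unset Printing Implicit Defensive.

Import Order.TTheory GRing.Theory Num.Theory.
Import numFieldNormedType.Exports.

Local Open Scope classical_set_scope.
Local Open Scope ring_scope.

(** Write psi = P (z^-2 e^(xz)) with the second order operator
    P = d^2 + A1 d + A0, where A1 and A0 are rational matrices with poles at 0
    and 2 only.  Right multiplication of e^(xz) by F(z) is the constant
    coefficient operator F(d), so L psi = psi F says L P = P F(d).  Right
    division by P shows that such an L exists exactly when F(d) maps the
    kernel V of P into itself.  Here V is spanned by the vector polynomials

      (x^2, 0),   (0, 1),   (1 - 2 x, 2 x),   (- 2 x, x^2),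

    and a vector (u0 + u1 x + u2 x^2, v0 + v1 x + v2 x^2) lies in V exactly
    when v1 = 2 u0 and u1 + v1 + 2 v2 = 0.  Testing these two conditions on the
    images of the four vectors gives the seven linear conditions on the
    coefficients of 1, z and z^2 in F that define Gamma; higher powers of z
    act by zero on V, whose members have degree at most 2.

    The proof below never composes operators.  As d^3 kills V, it is a multiple
    of P, and in fact d^3 = (d - A1) P; that is, psi' = A1 psi + z e^(xz).
    Therefore the functions

      psi,   z e^(xz),   z^2 e^(xz),   ...

    and the successive derivatives of psi are two families of generators of one
    left module over the rational matrices with poles at 0 and 2, and the
    change of generators is triangular with identities on the diagonal
    ([dpsi_wave], [left_span_wave]).  So psi F is obtained from psi by a
    differential operator as soon as it is a combination of the first family.
    Since z^2 e^(-xz) psi is the polynomial N(z) = z^2 + A1 z + A0, this means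
    that N F and Lambda N agree modulo z^3 for some matrix Lambda, a property
    that holds at any one point x outside 0 and 2 if and only if F is in Gamma
    ([dress_intertwining_necessary], [dress_intertwining_sufficient]).

    For Gamma inside the algebra, Lambda is a rational function of x and the
    operator has coefficients that are holomorphic on the disc of radius 1
    around 1.  For the converse, one point of U at which all the coefficients
    are holomorphic is enough: meromorphic coefficients have such a point, the
    given identity becomes there an identity between polynomials in z, and its
    three lowest coefficients are the congruence modulo z^3. *)

(** * First order expansions and the complex exponential *)

(** The difference quotient is undefined at 0; this form without division can be
    transported between R and the complex numbers and used componentwise. *)
Lemma is_derive1P (K : numFieldType) (f : K -> K) (x d : K) :
  is_derive x 1 f d <->
  forall e, 0 < e ->
    \forall h \near (0 : K), `|f (x + h) - f x - d * h| <= e * `|h|.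
Proof.
have quot h : h != 0 -> d - h^-1 * (f (h + x) - f x) =
                        - (h^-1 * (f (x + h) - f x - d * h)).
  by move=> h0; rewrite [h + x]addrC; field.
have dE : (fun h => h^-1 *: ((f \o shift x) (h *: 1) - f x)) =
          (fun h => h^-1 * (f (h + x) - f x)).
  by apply/funext => h /=; rewrite /GRing.scale /= mulr1.
split=> [[df dfE] e e0|df].
  have /cvgrPdist_le/(_ e e0) :
      (fun h => h^-1 * (f (h + x) - f x)) @ 0^' --> d.
    by rewrite -dfE -dE; exact: df.
  rewrite near_withinE => lim; near=> h.
  have [->|h0] := eqVneq h 0.
    by rewrite addr0 subrr mulr0 subr0 !normr0 mulr0.
  have {}hle : `|d - h^-1 * (f (h + x) - f x)| <= e by apply: (near lim h).
  move: hle; rewrite quot // normrN normrM normfV.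
  by rewrite mulrC ler_pdivrMr ?normr_gt0.
have lim : (fun h => h^-1 * (f (h + x) - f x)) @ 0^' --> d.
  apply/cvgrPdist_le => e e0; rewrite near_withinE.
  have {}df := df e e0; near=> h => h0.
  have hle : `|f (x + h) - f x - d * h| <= e * `|h| by near: h.
  by rewrite quot // normrN normrM normfV mulrC ler_pdivrMr ?normr_gt0.
apply: DeriveDef; first by rewrite /derivable dE; apply: (cvgP d).
by rewrite /derive dE; exact: (cvg_lim (@norm_hausdorff K K) lim).
Unshelve. all: by end_near. Qed.

Lemma expCD (R : realType) (v w : Cplx R) : expC (v + w) = expC v * expC w.
Proof.
case: v w => [a b] [c d]; rewrite /expC /= expRD cosD sinD.
apply/eqP; rewrite eq_complex /=; apply/andP; split; apply/eqP; ring.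
Qed.

Lemma expC0 (R : realType) : expC (0 : Cplx R) = 1.
Proof. by rewrite /expC /= expR0 cos0 sin0 mul1r. Qed.

Lemma expC_neq0 (R : realType) (w : Cplx R) : expC w != 0.
Proof.
apply/eqP => w0; have := expCD w (- w); rewrite subrr w0 mul0r expC0.
by move/eqP; rewrite oner_eq0.
Qed.

Lemma ge_norm_Re (R : realType) (w : Cplx R) : (`|complex.Re w|)%:C%C <= `|w|.
Proof.
case: w => a b; rewrite normc_def /= lecR -sqrtr_sqr.
rewrite ler_sqrt ?lerDl ?sqr_ge0 //.
by rewrite addr_ge0 ?sqr_ge0.
Qed.

Lemma ge_norm_Im (R : realType) (w : Cplx R) : (`|complex.Im w|)%:C%C <= `|w|.
Proof.
case: w => a b; rewrite normc_def /= lecR -sqrtr_sqr.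
rewrite ler_sqrt ?lerDr ?sqr_ge0 //.
by rewrite addr_ge0 ?sqr_ge0.
Qed.

Lemma norm_le_ReIm (R : realType) (w : Cplx R) :
  `|w| <= (`|complex.Re w| + `|complex.Im w|)%:C%C.
Proof.
case: w => a b; rewrite normc_def /= lecR -[leRHS]ger0_norm ?addr_ge0 //.
rewrite -sqrtr_sqr ler_sqrt ?sqr_ge0 // sqrrD !real_normK ?num_real //.
by rewrite lerD2r lerDl mulrn_wge0 ?mulr_ge0.
Qed.

Lemma near0_ReIm (R : realType) (P : R -> Prop) :
  (\forall t \near (0 : R), P t) ->
  \forall w \near (0 : Cplx R), P (complex.Re w) /\ P (complex.Im w).
Proof.
move=> /nbhs_normP[d /= d0 dP]; apply/nbhs_normP; exists d%:C%C => /=.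
  by rewrite ltcR.
move=> w; rewrite /ball_ /= sub0r normrN => wd.
by split; apply: dP; rewrite /ball_ /= sub0r normrN -ltcR;
  [apply: le_lt_trans (ge_norm_Re w) wd|apply: le_lt_trans (ge_norm_Im w) wd].
Qed.

(** With h = a + b i, both components of e^h - 1 - h are combinations of the
    real remainders e^a - 1 - a, cos b - 1 and sin b - b, each of which is at
    most d times |a| or |b| near 0. *)
Lemma is_derive_expC0 (R : realType) : is_derive (0 : Cplx R) 1 (@expC R) 1.
Proof.
apply/is_derive1P => -[e e'] e0.
have := e0; rewrite (ltcE (0 : R[i])) /= => /andP[/eqP e'0 {}e0]; rewrite {}e'0.
(* the two component bounds add up to d |a| + 7 d |b|, at most 8 d |h| *)
pose d := Num.min 1 (e / 8).
have d0 : 0 < d by rewrite lt_min ltr01 divr_gt0.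
have d1 : d <= 1 by rewrite ge_min lexx.
have de : 8 * d <= e by rewrite mulrC -ler_pdivlMr // ge_min lexx orbT.
have := (is_derive1P _ _ _).1 (is_derive_expR (0 : R)) d d0.
move=> /near0_ReIm nexp.
have := (is_derive1P _ _ _).1 (is_derive_cos (0 : R)) d d0.
move=> /near0_ReIm ncos.
have := (is_derive1P _ _ _).1 (is_derive_sin (0 : R)) d d0.
move=> /near0_ReIm nsin.
have : \forall t \near (0 : R), `|t| < d by apply: nbhs0_lt.
move=> /near0_ReIm nball.
apply: filterS (filterI (filterI nexp ncos) (filterI nsin nball)).
move=> h [[[ha _] [_ hb]] [[_ hc] [hd _]]].
move: ha hb hc hd (ge_norm_Re h) (ge_norm_Im h); case: h => a b /=.
rewrite !add0r expR0 cos0 sin0 oppr0 mul0r !mul1r addr0 !subr0 expC0.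
move=> ha hb hc hd hRe hIm.
have a1 : `|a| <= 1 by apply: le_trans (ltW hd) d1.
have re : `|expR a * cos b - 1 - a| <= d * `|a| + 2 * d * `|b|.
  have -> : expR a * cos b - 1 - a =
            (expR a - 1 - a) * cos b + (1 + a) * (cos b - 1) by ring.
  rewrite (le_trans (ler_normD _ _)) // !normrM lerD //.
    by rewrite -[leRHS]mulr1 ler_pM // cos_max.
  rewrite -mulrA ler_pM // (le_trans (ler_normD _ _)) // normr1.
  by rewrite -[leRHS]/(1 + 1) lerD2l.
have im : `|expR a * sin b - b| <= 5 * d * `|b|.
  have -> : expR a * sin b - b =
            ((expR a - 1 - a) + a) * ((sin b - b) + b) + (sin b - b) by ring.
  have -> : 5 * d * `|b| = (d + d) * (`|b| + `|b|) + d * `|b| by ring.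
  apply: le_trans (ler_normD _ _) _; apply: lerD => //; rewrite normrM.
  apply: ler_pM => //; apply: le_trans (ler_normD _ _) _; apply: lerD => //.
  - by apply: le_trans ha _; rewrite ler_piMr // ltW.
  - exact: ltW.
  - by apply: le_trans hc _; rewrite ler_piMl.
apply: le_trans (norm_le_ReIm _) _; rewrite /= !mul0r subr0 addr0 oppr0 !addr0.
move: hRe hIm; rewrite normc_def; set n := Num.sqrt _; rewrite !lecR => an bn.
rewrite -[(e +i* 0)%C]/(e%:C%C) -rmorphM lecR /=.
have n0 : 0 <= n by exact: sqrtr_ge0.
apply: le_trans (lerD re im) _; apply: (@le_trans _ _ (8 * d * n)); last first.
  by rewrite ler_wpM2r.
have := ler_wpM2l (ltW d0) an; have := ler_wpM2l (ltW d0) bn; lra.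
Qed.

Lemma is_derive_expC (R : realType) (w : Cplx R) :
  is_derive w 1 (@expC R) (expC w).
Proof.
apply/is_derive1P => e e0; have w0 := expC_neq0 w.
have ew0 : 0 < e / `|expC w| by rewrite divr_gt0 ?normr_gt0.
have exp0 := (is_derive1P _ _ _).1 (is_derive_expC0 R) _ ew0.
apply: filterS exp0 => h; rewrite add0r expC0 mul1r.
have -> : expC (w + h) - expC w - expC w * h = expC w * (expC h - 1 - h).
  by rewrite expCD; ring.
by move=> hle; rewrite normrM mulrC -ler_pdivlMr ?normr_gt0 // mulrAC.
Qed.

(** * Derivatives over a numeric field *)

Lemma is_derive_horner (K : numFieldType) (q : {poly K}) (x : K) :
  is_derive x 1 (horner q) q^`().[x].
Proof.
elim/poly_ind: q => [|q c IH].
  have -> : horner (0 : {poly K}) = cst 0 by apply/funext => y; rewrite horner0.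
  by rewrite deriv0 horner0; exact: is_derive_cst.
have -> : horner (q * 'X + c%:P) = horner q * id + cst c.
  by apply/funext => y; rewrite hornerD hornerMX hornerC.
apply: is_derive_eq.
rewrite derivD derivM derivX derivC mulr1 !addr0 hornerD hornerMX.
by rewrite /GRing.scale /=; ring.
Qed.

Lemma is_derive_continuous (K : numFieldType) (f : K -> K) (x d : K) :
  is_derive x 1 f d -> {for x, continuous f}.
Proof. by move=> [df _]; apply/differentiable_continuous/derivable1_diffP. Qed.

Lemma is_deriveV (K : numFieldType) (f : K -> K) (x d : K) :
  f x != 0 -> is_derive x 1 f d ->
  is_derive x 1 (fun y => (f y)^-1) (- d / f x ^+ 2).
Proof.
move=> fx0 [df <-]; apply: DeriveDef; first exact: derivableV.
by rewrite deriveV // /GRing.scale /= !mulNr mulrC.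
Qed.

Lemma is_derive_comp (K : numFieldType) (f g : K -> K) (x df dg : K) :
  is_derive x 1 f df -> is_derive (f x) 1 g dg ->
  is_derive x 1 (g \o f) (dg * df).
Proof.
move=> [/derivable1_diffP fx <-] [/derivable1_diffP gfx <-].
have gf : differentiable (g \o f) x by exact: differentiable_comp.
apply: DeriveDef; first exact/derivable1_diffP.
rewrite (deriveE (1 : K) gf) (deriveE (1 : K) fx) (deriveE (1 : K) gfx).
transitivity ('d g (f x) ('d f x 1 *: 1)).
  rewrite -[X in _ = 'd g (f x) X]/('d f x 1 * 1) mulr1.
  by have /(congr1 (fun h => h 1)) := diff_comp fx gfx.
by rewrite [LHS]linearZ mulrC.
Qed.

Lemma near_neq (K : numFieldType) (x c : K) :
  x != c -> \forall y \near x, y != c.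
Proof.
have XcE (y : K) : ('X - c%:P).[y] = y - c by rewrite hornerXsubC.
rewrite -subr_eq0 -XcE => xc.
have /cvgr_neq0/(_ xc) near_Xc :=
  is_derive_continuous (is_derive_horner ('X - c%:P) x).
by apply: filterS near_Xc => y; rewrite XcE subr_eq0.
Qed.

Lemma nonsingularP (K : numFieldType) (x : K) :
  x * (x - 2) != 0 <-> x != 0 /\ x != 2.
Proof. by rewrite mulf_eq0 negb_or subr_eq0; split=> [/andP|[-> ->]]. Qed.

Lemma near_nonsingular (K : numFieldType) (x : K) :
  x * (x - 2) != 0 -> \forall y \near x, y * (y - 2) != 0.
Proof.
move=> /nonsingularP[x0 x2].
apply: filterS (filterI (near_neq x0) (near_neq x2)) => y [y0 y2].
by apply/nonsingularP.
Qed.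

(** * Rational functions with poles at 0 and 2 *)

(** The coefficients of all operators below; the values at 0 and at 2 are left
    free, so that every rational expression with these poles qualifies. *)
Definition regular (K : numFieldType) (f : K -> K) : Prop :=
  exists (q : {poly K}) (k : nat),
    forall x : K, x * (x - 2) != 0 -> f x = q.[x] / (x * (x - 2)) ^+ k.

Section Regular.
Variable K : numFieldType.
Implicit Types f g : K -> K.

Lemma regular_cst (c : K) : regular (fun _ : K => c).
Proof. by exists c%:P, 0%N => x _; rewrite hornerC divr1. Qed.

Lemma regular_id : regular (fun x : K => x).
Proof. by exists 'X, 0%N => x _; rewrite hornerX divr1. Qed.

Lemma regular_inv : regular (fun x : K => x^-1).
Proof.
exists ('X - 2%:P), 1%N => x /nonsingularP[x0 x2].
by rewrite hornerXsubC expr1; field; rewrite x0 subr_eq0 x2.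
Qed.

Lemma regular_sing_inv : regular (fun x : K => (x * (x - 2))^-1).
Proof. by exists 1, 1%N => x _; rewrite hornerC div1r expr1. Qed.

Lemma regularD f g :
  regular f -> regular g -> regular (fun x => f x + g x).
Proof.
move=> [q [k fE]] [r [l gE]]; pose s : {poly K} := 'X * ('X - 2%:P).
exists (q * s ^+ l + r * s ^+ k), (k + l)%N => x x0.
rewrite fE // gE // hornerD !hornerM !horner_exp hornerM hornerXsubC hornerX.
by rewrite exprD; field; rewrite !expf_neq0.
Qed.

Lemma regularM f g :
  regular f -> regular g -> regular (fun x => f x * g x).
Proof.
move=> [q [k fE]] [r [l gE]]; exists (q * r), (k + l)%N => x x0.
by rewrite fE // gE // hornerM exprD invfM mulrACA.
Qed.

Lemma regularN f : regular f -> regular (fun x => - f x).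
Proof.
move=> freg; under eq_fun do rewrite -mulN1r.
by apply: regularM => //; exact: regular_cst.
Qed.

Lemma regular_sum (I : Type) (r : seq I) (f : I -> K -> K) :
  (forall i, regular (f i)) -> regular (fun x => \sum_(i <- r) f i x).
Proof.
move=> freg; elim: r => [|i r IH].
  by under eq_fun do rewrite big_nil; exact: regular_cst.
by under eq_fun do rewrite big_cons; exact: regularD.
Qed.

Lemma regular_derive f : regular f ->
  exists2 g : K -> K, regular g &
    forall x : K, x * (x - 2) != 0 -> is_derive x 1 f (g x).
Proof.
move=> [q [k fE]]; pose s : {poly K} := 'X * ('X - 2%:P).
have sE (y : K) : s.[y] = y * (y - 2) by rewrite hornerM hornerXsubC hornerX.
pose r := q^`() * s ^+ k - q * (s ^+ k)^`().
exists (fun x : K => r.[x] / (x * (x - 2)) ^+ (2 * k)).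
  by exists r, (2 * k)%N.
move=> x x0; have sk0 : (s ^+ k).[x] != 0 by rewrite horner_exp sE expf_neq0.
have near_f : \forall y \near x,
    (horner q * (fun y => (s ^+ k).[y]^-1)) y = f y.
  near=> y; rewrite fE /=; last by near: y; exact: near_nonsingular.
  by rewrite -sE -horner_exp.
apply: near_eq_is_derive near_f _.
have dV := is_deriveV sk0 (is_derive_horner (s ^+ k) x).
apply: is_derive_eq (is_deriveM (is_derive_horner q x) dV) _.
have -> : (x * (x - 2)) ^+ (2 * k) = (s ^+ k).[x] ^+ 2.
  by rewrite mulnC exprM -sE horner_exp.
rewrite /GRing.scale /= /r hornerD hornerN !hornerM.
by field.
Unshelve. all: by end_near. Qed.

Lemma regular_meromorphic f (x : K) :
  regular f -> x * (x - 2) != 0 -> meromorphic_at f x.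
Proof.
move=> /regular_derive[g _ fg] x0; exists 0%N, f; split.
  by apply: filterS (near_nonsingular x0) => y /fg[].
by near=> y; rewrite expr0 mul1r.
Unshelve. all: by end_near. Qed.

End Regular.

(** * Matrices of functions *)

Definition regular_mx (K : numFieldType) m n (A : K -> 'M[K]_(m, n)) : Prop :=
  forall i j, regular (fun x => A x i j).

Definition is_derive_mx (K : numFieldType) m n
    (A : K -> 'M[K]_(m, n)) (x : K) (dA : 'M[K]_(m, n)) : Prop :=
  forall i j, is_derive x 1 (fun y => A y i j) (dA i j).

Section RegularMatrices.
Variable K : numFieldType.

Lemma regular_mx_cst m n (A : 'M[K]_(m, n)) : regular_mx (fun _ => A).
Proof. by move=> i j; exact: regular_cst. Qed.

Lemma regular_mxD m n (A B : K -> 'M[K]_(m, n)) :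
  regular_mx A -> regular_mx B -> regular_mx (fun x => A x + B x).
Proof.
by move=> Areg Breg i j; under eq_fun do rewrite mxE; exact: regularD.
Qed.

Lemma regular_mxM m n p (A : K -> 'M[K]_(m, n)) (B : K -> 'M[K]_(n, p)) :
  regular_mx A -> regular_mx B -> regular_mx (fun x => A x *m B x).
Proof.
move=> Areg Breg i j; under eq_fun do rewrite mxE.
by apply: regular_sum => k; exact: regularM.
Qed.

Lemma regular_mxZ m n (f : K -> K) (A : K -> 'M[K]_(m, n)) :
  regular f -> regular_mx A -> regular_mx (fun x => f x *: A x).
Proof. by move=> fr Ar i j; under eq_fun do rewrite mxE; exact: regularM. Qed.

Lemma regular_mx_mx22 (a b c d : K -> K) :
  regular a -> regular b -> regular c -> regular d ->
  regular_mx (fun x => mx22 (a x) (b x) (c x) (d x)).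
Proof.
move=> ra rb rc rd i j; under eq_fun do rewrite mxE.
by case: (i == 0%N :> nat); case: (j == 0%N :> nat).
Qed.

Lemma regular_mx_derive m n (A : K -> 'M[K]_(m, n)) : regular_mx A ->
  exists2 dA : K -> 'M[K]_(m, n), regular_mx dA &
    forall x : K, x * (x - 2) != 0 -> is_derive_mx A x (dA x).
Proof.
move=> Areg.
have /choice[g gP] : forall ij : 'I_m * 'I_n, exists g : K -> K, regular g /\
    forall x : K, x * (x - 2) != 0 ->
      is_derive x 1 (fun y => A y ij.1 ij.2) (g x).
  by move=> [i j]; have [g] := regular_derive (Areg i j); exists g.
exists (fun x => \matrix_(i, j) g (i, j) x) => [i j|x x0 i j].
  by under eq_fun do rewrite mxE; have [] := gP (i, j).
by rewrite mxE; have [_] := gP (i, j); apply.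
Qed.

Lemma is_derive_mx_cst m n (A : 'M[K]_(m, n)) (x : K) :
  is_derive_mx (fun _ => A) x 0.
Proof. by move=> i j; rewrite mxE; exact: is_derive_cst. Qed.

Lemma is_derive_mx_eq m n (A : K -> 'M[K]_(m, n)) (x : K) dA dA' :
  is_derive_mx A x dA -> dA = dA' -> is_derive_mx A x dA'.
Proof. by move=> ? <-. Qed.

Lemma is_derive_mxD m n (A B : K -> 'M[K]_(m, n)) (x : K) dA dB :
  is_derive_mx A x dA -> is_derive_mx B x dB ->
  is_derive_mx (fun y => A y + B y) x (dA + dB).
Proof.
move=> dAx dBx i j; under eq_fun do rewrite mxE.
by rewrite mxE; exact: is_deriveD.
Qed.

Lemma is_derive_mx_sum m n p (A : 'I_p -> K -> 'M[K]_(m, n)) (x : K) dA :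
  (forall k, is_derive_mx (A k) x (dA k)) ->
  is_derive_mx (fun y => \sum_k A k y) x (\sum_k dA k).
Proof.
move=> dAx i j; under eq_fun do rewrite summxE.
rewrite summxE -[X in is_derive _ _ X _]fct_sumE.
by apply: is_derive_sum => k; exact: dAx.
Qed.

Lemma is_derive_mxM m n p (A : K -> 'M[K]_(m, n)) (B : K -> 'M[K]_(n, p))
    (x : K) dA dB :
  is_derive_mx A x dA -> is_derive_mx B x dB ->
  is_derive_mx (fun y => A y *m B y) x (dA *m B x + A x *m dB).
Proof.
move=> dAx dBx i j; under eq_fun do rewrite mxE.
rewrite -[X in is_derive _ _ X _](fct_sumE _ _ (fun k y => A y i k * B y k j)).
rewrite !mxE -big_split /=; apply: is_derive_sum => k.
apply: is_derive_eq (is_deriveM (dAx i k) (dBx k j)) _.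
by rewrite /GRing.scale /=; ring.
Qed.

Lemma is_derive_scalar_mx n (f : K -> K) (x d : K) :
  is_derive x 1 f d -> is_derive_mx (fun y => (f y)%:M : 'M[K]_n) x d%:M.
Proof.
move=> df i j; under eq_fun do rewrite mxE; rewrite mxE.
by case: eqP => _ //; under eq_fun do rewrite mulr0n; exact: is_derive_cst.
Qed.

Lemma is_derive_mx22 (a b c d : K -> K) (x : K) (da db dc dd : K) :
  is_derive x 1 a da -> is_derive x 1 b db ->
  is_derive x 1 c dc -> is_derive x 1 d dd ->
  is_derive_mx (fun y => mx22 (a y) (b y) (c y) (d y)) x (mx22 da db dc dd).
Proof.
move=> ha hb hc hd i j; rewrite mxE; under eq_fun do rewrite mxE.
by case: (i == 0%N :> nat); case: (j == 0%N :> nat).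
Qed.

Lemma near_eq_is_derive_mx m n (A B : K -> 'M[K]_(m, n)) (x : K) dA :
  (\forall y \near x, A y = B y) -> is_derive_mx A x dA -> is_derive_mx B x dA.
Proof.
move=> AB dAx i j; apply: near_eq_is_derive (dAx i j).
by apply: filterS AB => y ->.
Qed.

Lemma mx_derive1n_derive m n k (A : K -> 'M[K]_(m, n)) (x : K) dA :
  is_derive_mx (mx_derive1n k A) x dA -> mx_derive1n k.+1 A x = dA.
Proof.
move=> dAx; apply/matrixP => i j; rewrite mxE derive1nS derive1E.
have := dAx i j; under eq_fun do rewrite mxE.
by move=> [_ <-].
Qed.

End RegularMatrices.

(** * Matrix polynomials evaluated at scalar matrices *)

Lemma expr_scalar_mx (K : numFieldType) n (z : K) (k : nat) :
  (z%:M : 'M[K]_n.+1) ^+ k = (z ^+ k)%:M.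
Proof.
elim: k => [|k IH]; first by rewrite !expr0.
by rewrite !exprS IH -mulmxE -scalar_mxM.
Qed.

Lemma hornerZM (K : numFieldType) n (P : {poly 'M[K]_n.+1}) (m : nat) (z : K) :
  (size P <= m)%N -> P.[z%:M] = \sum_(k < m) z ^+ k *: P`_k.
Proof.
move=> sizeP; rewrite (horner_coef_wide _ sizeP); apply: eq_bigr => k _.
by rewrite expr_scalar_mx -mulmxE mul_mx_scalar.
Qed.

Lemma hornerM_scalar (K : numFieldType) n (P Q : {poly 'M[K]_n.+1}) (z : K) :
  (P * Q).[z%:M] = P.[z%:M] *m Q.[z%:M].
Proof.
by rewrite hornerM_comm // /comm_poly -!mulmxE scalar_mxC.
Qed.

Lemma poly_zero_off0 (K : numFieldType) (p : {poly K}) :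
  (forall z : K, z != 0 -> p.[z] = 0) -> p = 0.
Proof.
move=> p0.
apply: (@roots_geq_poly_eq0 _ _ [seq n.+1%:R | n <- iota 0 (size p)]).
- by apply/allP => _ /mapP[n _ ->]; rewrite rootE p0 // pnatr_eq0.
- rewrite map_inj_uniq ?iota_uniq // => m n /eqP.
  by rewrite eqr_nat eqSS => /eqP.
- by rewrite size_map size_iota.
Qed.

Lemma poly_mx_inj_off0 (K : numFieldType) n (P Q : {poly 'M[K]_n.+1}) :
  (forall z : K, z != 0 -> P.[z%:M] = Q.[z%:M]) -> P = Q.
Proof.
move=> PQ; apply/eqP; rewrite -subr_eq0; apply/eqP/polyP => k; rewrite coef0.
have [kD|Dk] := ltnP k (size (P - Q)); last by rewrite nth_default.
apply/matrixP => i j; rewrite mxE.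
pose p := \poly_(k < size (P - Q)) (P - Q)`_k i j.
suff p0 : p = 0.
  have := coef_poly (size (P - Q)) (fun k => (P - Q)`_k i j) k.
  by rewrite -/p p0 coef0 kD => <-.
apply: poly_zero_off0 => z z0; rewrite horner_poly.
transitivity ((P - Q).[z%:M] i j).
  rewrite (hornerZM _ (leqnn _)) summxE.
  by apply: eq_bigr => m _; rewrite [RHS]mxE mulrC.
by rewrite hornerD hornerN PQ // subrr mxE.
Qed.

(** * The dressing operator *)

Section Dressing.
Variable K : numFieldType.

(** The coefficients A1 and A0 of P. *)
Definition dress1 (x : K) : 'M[K]_2 :=
  (x * (x - 2))^-1 *: mx22 (3 - 2 * x) x^-1 x (1 - x).

Definition dress0 (x : K) : 'M[K]_2 :=
  (x * (x - 2))^-1 *: mx22 ((2 * x - 2) / x) 0 (- 2) 0.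

(** The symbol of P, the polynomial N(z) of the introduction. *)
Definition dress (x : K) : {poly 'M[K]_2} :=
  'X^2 + (dress1 x)%:P * 'X + (dress0 x)%:P.

Lemma regular_dress1 : regular_mx dress1.
Proof.
apply: regular_mxZ; first exact: regular_sing_inv.
have id := regular_id; have cst := @regular_cst K.
apply: regular_mx_mx22; [|exact: regular_inv|exact: id|];
  by apply: regularD => //; apply: regularN => //; apply: regularM.
Qed.

Lemma regular_dress0 : regular_mx dress0.
Proof.
apply: regular_mxZ; first exact: regular_sing_inv.
apply: regular_mx_mx22; try exact: regular_cst.
apply: regularM; last exact: regular_inv.
apply: regularD; last exact: regular_cst.
by apply: regularM; [exact: regular_cst|exact: regular_id].
Qed.

Local Notation poly_derivE :=
  (derivB, derivD, derivN, derivM, derivXn, derivX, derivC).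

(** The quotient rule for the common denominator x^2 (x - 2) of all entries of
    A1 and A0, with one factor x cancelled. *)
Lemma is_derive_fraction (f : K -> K) (p : {poly K}) (x d : K) :
  (forall y : K, y != 0 -> y - 2 != 0 -> f y = p.[y] / (y ^+ 2 * (y - 2))) ->
  x != 0 -> x - 2 != 0 ->
  d = (p^`().[x] * (x * (x - 2)) - p.[x] * (3 * x - 4)) /
        (x ^+ 3 * (x - 2) ^+ 2) ->
  is_derive x 1 f d.
Proof.
move=> fE x0 x2 ->; pose q : {poly K} := 'X^2 * ('X - 2%:P).
have qE (y : K) : q.[y] = y ^+ 2 * (y - 2).
  by rewrite hornerM hornerXn hornerXsubC.
have q0 : q.[x] != 0 by rewrite qE mulf_neq0 ?expf_neq0.
have near_f : \forall y \near x, (horner p * (fun y => q.[y]^-1)) y = f y.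
  have x02 : x * (x - 2) != 0 by rewrite mulf_neq0.
  apply: filterS (near_nonsingular x02) => y; rewrite mulf_eq0 negb_or.
  by move=> /andP[y0 y2]; rewrite fE //= -qE.
apply: near_eq_is_derive near_f _.
have dV := is_deriveV q0 (is_derive_horner q x).
apply: is_derive_eq (is_deriveM (is_derive_horner p x) dV) _.
have -> : q^`().[x] = x * (3 * x - 4).
  by rewrite /q !poly_derivE !hornerE /=; ring.
by rewrite qE /GRing.scale /=; field; rewrite x0 x2.
Qed.

Local Ltac derive_fraction x0 x2 p :=
  let y := fresh in let y0 := fresh in let y2 := fresh in
  apply: (@is_derive_fraction _ p) => // [y y0 y2|];
  [ rewrite !hornerE /=; field; rewrite ?y0 ?y2 //
  | rewrite !poly_derivE !hornerE /=; field; rewrite ?x0 ?x2 // ].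

(** This and the next identity are the coefficients of 1 and d in
    (d - A1) (d^2 + A1 d + A0) = d^3. *)
Lemma is_derive_dress0 (x : K) : x * (x - 2) != 0 ->
  is_derive_mx dress0 x (dress1 x *m dress0 x).
Proof.
move=> /nonsingularP[x0 x2]; have {}x2 : x - 2 != 0 by rewrite subr_eq0.
rewrite /dress0 /dress1 !mx22Z mulmxE mx22M.
under [X in is_derive_mx X]eq_fun do rewrite mx22Z.
apply: is_derive_mx22.
- by derive_fraction x0 x2 (2%:P * 'X - 2%:P : {poly K}).
- by derive_fraction x0 x2 (0 : {poly K}).
- by derive_fraction x0 x2 (- 2%:P * 'X : {poly K}).
- by derive_fraction x0 x2 (0 : {poly K}).
Qed.

Lemma is_derive_dress1 (x : K) : x * (x - 2) != 0 ->
  is_derive_mx dress1 x (dress1 x *m dress1 x - dress0 x).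
Proof.
move=> /nonsingularP[x0 x2]; have {}x2 : x - 2 != 0 by rewrite subr_eq0.
rewrite -scaleN1r /dress0 /dress1 !mx22Z mulmxE mx22M mx22D.
under [X in is_derive_mx X]eq_fun do rewrite mx22Z.
apply: is_derive_mx22.
- by derive_fraction x0 x2 (3%:P * 'X - 2%:P * 'X^2 : {poly K}).
- by derive_fraction x0 x2 (1 : {poly K}).
- by derive_fraction x0 x2 ('X^2 : {poly K}).
- by derive_fraction x0 x2 ('X - 'X^2 : {poly K}).
Qed.

Lemma dress_horner (x z : K) :
  (dress x).[z%:M] = (z ^+ 2)%:M + z%:M *m dress1 x + dress0 x.
Proof.
rewrite /dress hornerD hornerD hornerXn expr_scalar_mx hornerMX.
by rewrite (hornerC (dress1 x)) (hornerC (dress0 x)) -mulmxE scalar_mxC.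
Qed.

(** The cancellation behind psi' = A1 psi + z e^(xz), with e, B1 and B0 in place
    of e^(xz), A1^2 and A1 A0. *)
Lemma dress_wave_identity (e z : K) (A1 A0 B1 B0 : 'M[K]_2) : z != 0 ->
  (e * z ^+ 2) *: (z ^- 3 *: ((z ^+ 2)%:M + z *: A1 + A0)) +
  (e * z ^+ 1) *: (z ^- 3 *: (z *: (B1 - A0) + B0)) =
  (e * z ^+ 1) *: (z ^- 3 *: (z ^+ 2 *: A1 + z *: B1 + B0)) + (e * z)%:M.
Proof. by move=> z0; apply/matrixP => i j; rewrite !mxE; field. Qed.

Lemma coef_dressM (x : K) (F : {poly 'M[K]_2}) :
  [/\ (dress x * F)`_0 = dress0 x * F`_0,
      (dress x * F)`_1 = dress1 x * F`_0 + dress0 x * F`_1 &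
      forall k, (dress x * F)`_k.+2 =
        F`_k + dress1 x * F`_k.+1 + dress0 x * F`_k.+2].
Proof.
have coefE k : (dress x * F)`_k =
    ('X^2 * F)`_k + dress1 x * ('X * F)`_k + dress0 x * F`_k.
  by rewrite /dress !mulrDl !coefD -[_%:P * 'X * F]mulrA !coefCM.
by split=> [||k]; rewrite coefE coefXnM coefXM /= ?mulr0 ?addr0 ?add0r // subn2.
Qed.

Lemma coef_Cdress (x : K) (L : 'M[K]_2) :
  [/\ (L%:P * dress x)`_0 = L * dress0 x, (L%:P * dress x)`_1 = L * dress1 x,
      (L%:P * dress x)`_2 = L & forall k, (L%:P * dress x)`_k.+3 = 0].
Proof.
by split=> [|||k]; rewrite coefCM /dress !coefD coefXn coefMX !coefC /=
  ?addr0 ?add0r ?mulr0 ?mulr1.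
Qed.

End Dressing.

(** * Stability of the kernel of P *)

Section Kernel.
Variable K : numFieldType.

Lemma mx22_eta (T : Type) (A : 'M[T]_2) :
  A = mx22 (A 0 0) (A 0 1) (A 1 0) (A 1 1).
Proof.
apply/matrixP => i j; rewrite mxE.
by case: i j => -[|[|//]] ? [[|[|//]] ?] /=; congr (A _ _); exact: val_inj.
Qed.

Lemma mx22_inj (T : Type) (a b c d a' b' c' d' : T) :
  mx22 a b c d = mx22 a' b' c' d' -> [/\ a = a', b = b', c = c' & d = d'].
Proof.
move=> /matrixP eqM; have := eqM 0 0; have := eqM 0 1.
by have := eqM 1 0; have := eqM 1 1; rewrite !mxE.
Qed.

(** The hypotheses are the two rows of P w = 0 at the point x, for
    w = (u0 + u1 x + u2 x^2, v0 + v1 x + v2 x^2).  With m = v1 - 2 u0 and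
    n = u1 + v1 + 2 v2 they are, up to nonzero factors, m + x (n - m) = 0 and
    m - x n = 0.  The sum is m (2 - x) = 0, so both m and n vanish: a single
    ordinary point decides whether w is in the kernel. *)
Lemma ker_jet (x u0 u1 u2 v1 v2 : K) : x * (x - 2) != 0 ->
  (x * (x - 2))^-1 * ((2 * x - 2) / x * (u0 + u1 * x + u2 * x ^+ 2)
     + (3 - 2 * x) * (u1 + 2 * u2 * x) + x^-1 * (v1 + 2 * v2 * x))
    + 2 * u2 = 0 ->
  (x * (x - 2))^-1 * (- 2 * (u0 + u1 * x + u2 * x ^+ 2)
     + x * (u1 + 2 * u2 * x) + (1 - x) * (v1 + 2 * v2 * x))
    + 2 * v2 = 0 ->
  v1 = 2 * u0 /\ u1 + v1 + 2 * v2 = 0.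
Proof.
move=> /nonsingularP[x0 x2]; have {}x2 : x - 2 != 0 by rewrite subr_eq0.
move=> eq1 eq2.
have eqd : (v1 - 2 * u0) * (x - 2) = 0.
  transitivity (- (x ^+ 2 * (x - 2) * 0 + x * (x - 2) * 0)); last by ring.
  by rewrite -{1}eq1 -eq2; field; rewrite x0 x2.
move: eqd => /eqP; rewrite mulf_eq0 (negPf x2) orbF subr_eq0 => /eqP v1E.
split=> //; suff /eqP : (u1 + v1 + 2 * v2) * x = 0.
  by rewrite mulf_eq0 (negPf x0) orbF => /eqP.
transitivity (- (x * (x - 2)) * 0); last by ring.
by rewrite -eq2 v1E; field; rewrite x0 x2.
Qed.

(** The hypotheses are the congruence of N F and L N modulo z^3.  They make the
    constant coefficient operator F0 + F1 d + F2 d^2 preserve the kernel of P;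
    [ker_jet] turns this into linear relations, two for each of the four basis
    vectors, one of them void. *)
Lemma dress_intertwining_necessary (x : K) (F0 F1 F2 L : 'M[K]_2) :
  x * (x - 2) != 0 ->
  dress0 x * F0 = L * dress0 x ->
  dress1 x * F0 + dress0 x * F1 = L * dress1 x ->
  F0 + dress1 x * F1 + dress0 x * F2 = L ->
  exists a b c d e : K,
    [/\ F0 = mx22 a 0 (b - a) b, F1 = mx22 c c (a - b - c) (- c) &
        F2 = 2^-1 *: mx22 (a - b - c) (c + a - b) d e].
Proof.
move=> x02 E0 E1 E2.
(* If the columns of S0, S1, S2 are the values, first and second derivatives at
   x of solutions of P w = 0, the hypotheses say that P kills their images under
   F(d) at x. *)
have stable S0 S1 S2 : dress0 x * S0 + dress1 x * S1 + S2 = 0 ->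
    dress0 x * (F0 * S0 + F1 * S1 + F2 * S2) + dress1 x * (F0 * S1 + F1 * S2)
      + F0 * S2 = 0.
  move=> ker; transitivity (L * (dress0 x * S0 + dress1 x * S1 + S2)).
    rewrite !mulrDr !mulrA -E0 -E1 -E2 !mulrDl.
    by rewrite [LHS](AC (3*2*1) ((1*(4*2))*(6*5*3))).
  by rewrite ker mulr0.
have [x0 x2] := (nonsingularP _).1 x02.
have {}x2 : x - 2 != 0 by rewrite subr_eq0.
have Z : 0 = mx22 0 0 0 0 :> 'M[K]_2.
  by apply/matrixP => i j; rewrite !mxE; do 2!case: ifP.
(* the solutions (x^2, 0) and (0, 1) *)
have ker12 : dress0 x * mx22 (x ^+ 2) 0 0 1 + dress1 x * mx22 (2 * x) 0 0 0
    + mx22 2 0 0 0 = 0.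
  rewrite /dress0 /dress1 !mx22Z !mx22M !mx22D Z.
  by congr mx22; field; rewrite ?x0 ?x2.
(* the solutions (1 - 2 x, 2 x) and (- 2 x, x^2) *)
have ker34 : dress0 x * mx22 (1 - 2 * x) (- 2 * x) (2 * x) (x ^+ 2)
    + dress1 x * mx22 (- 2) (- 2) 2 (2 * x) + mx22 0 0 0 2 = 0.
  rewrite /dress0 /dress1 !mx22Z !mx22M !mx22D Z.
  by congr mx22; field; rewrite ?x0 ?x2.
move: (stable _ _ _ ker12) (stable _ _ _ ker34).
rewrite (mx22_eta F0) (mx22_eta F1) (mx22_eta F2).
move: (F0 0 0) (F0 0 1) (F0 1 0) (F0 1 1) => f0 f1 f2 f3.
move: (F1 0 0) (F1 0 1) (F1 1 0) (F1 1 1) => g0 g1 g2 g3.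
move: (F2 0 0) (F2 0 1) (F2 1 0) (F2 1 1) => h0 h1 h2 h3.
rewrite /dress0 /dress1 !mx22Z !(mx22M, mx22D) Z.
move=> H12 H34.
have [e1 e2 e1' e2'] := mx22_inj H12; have [e3 e4 e3' e4'] := mx22_inj H34.
have [c1 c1'] : 2 * g2 = 2 * (2 * h0) /\ 2 * g0 + 2 * g2 + 2 * f2 = 0.
  apply: (@ker_jet x _ _ f0) x02 _ _.
    by rewrite -[RHS]e1; field; rewrite x0 x2.
  by rewrite -[RHS]e1'; field; rewrite x0 x2.
have [c2 _] : 0 = 2 * f1 /\ 0 + 0 + 2 * 0 = 0 :> K.
  apply: (@ker_jet x _ _ 0) x02 _ _.
    by rewrite -[RHS]e2; field; rewrite x0 x2.
  by rewrite -[RHS]e2'; field; rewrite x0 x2.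
have [c3 c3'] : 2 * f3 - 2 * f2 = 2 * (f0 - 2 * g0 + 2 * g1) /\
    2 * f1 - 2 * f0 + (2 * f3 - 2 * f2) + 2 * 0 = 0.
  apply: (@ker_jet x _ _ 0) x02 _ _.
    by rewrite -[RHS]e3; field; rewrite x0 x2.
  by rewrite -[RHS]e3'; field; rewrite x0 x2.
have [c4 c4'] : 2 * g3 - 2 * f2 = 2 * (2 * h1 - 2 * g0) /\
    2 * g1 - 2 * f0 + (2 * g3 - 2 * f2) + 2 * f3 = 0.
  apply: (@ker_jet x _ _ f1) x02 _ _.
    by rewrite -[RHS]e4; field; rewrite x0 x2.
  by rewrite -[RHS]e4'; field; rewrite x0 x2.
have two0 : 2 != 0 :> K by rewrite pnatr_eq0.
have half0 (u : K) : 2 * u = 0 -> u = 0.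
  by move/eqP; rewrite mulf_eq0 (negPf two0) => /eqP.
have half (u v : K) : 2 * (u - v) = 0 -> u = v.
  by move/half0/eqP; rewrite subr_eq0 => /eqP.
have f1E : f1 = 0 by apply: half; rewrite subr0 -c2.
have f2E : f2 = f3 - f0.
  apply: half; transitivity
    (2 * f1 - (2 * f1 - 2 * f0 + (2 * f3 - 2 * f2) + 2 * 0)); first by ring.
  by rewrite c3' f1E; ring.
have g2E : g2 = f0 - f3 - g0.
  apply: half; transitivity
    (2 * g0 + 2 * g2 + 2 * f2 - 2 * (f2 - (f3 - f0))); first by ring.
  by rewrite c1' f2E; ring.
have g1E : g1 = g0.
  apply/half/half0; transitivity (2 * (f0 - 2 * g0 + 2 * g1)
    - (2 * f3 - 2 * f2) + 2 * (f3 - f2 - f0)); first by ring.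
  by rewrite -c3 f2E; ring.
have g3E : g3 = - g0.
  apply: half; transitivity (2 * g1 - 2 * f0 + (2 * g3 - 2 * f2) + 2 * f3
    - 2 * g1 + 2 * f0 + 2 * f2 - 2 * f3 + 2 * g0); first by ring.
  by rewrite c4' g1E f2E; ring.
have h0E : 2 * h0 = f0 - f3 - g0 by rewrite -g2E; apply: (mulfI two0).
have h1E : 2 * h1 = g0 + f0 - f3.
  apply: half; transitivity (2 * (2 * h1 - 2 * g0) + 2 * g0 - 2 * f0 + 2 * f3).
    by ring.
  by rewrite -c4 g3E f2E; ring.
exists f0, f3, g0, (2 * h2), (2 * h3).
rewrite -h0E -h1E mx22Z !mulKf //.
by split; congr mx22 => //; rewrite h0E.
Qed.

Lemma dress_intertwining_sufficient (x a b c d e : K) :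
  x * (x - 2) != 0 ->
  let F0 := mx22 a 0 (b - a) b in
  let F1 := mx22 c c (a - b - c) (- c) in
  let F2 := 2^-1 *: mx22 (a - b - c) (c + a - b) d e in
  let L := F0 + dress1 x * F1 + dress0 x * F2 in
  dress0 x * F0 = L * dress0 x /\
  dress1 x * F0 + dress0 x * F1 = L * dress1 x.
Proof.
move=> x02 F0 F1 F2 L.
have [x0 x2] := (nonsingularP _).1 x02.
have {}x2 : x - 2 != 0 by rewrite subr_eq0.
rewrite /L /F0 /F1 /F2 /dress0 /dress1 !mx22Z !(mx22M, mx22D).
by split; congr mx22; field; rewrite ?x0 ?x2.
Qed.
End Kernel.

(** * Left modules over the regular matrices *)

Section LeftSpan.
Variable K : numFieldType.
Implicit Types (e : nat -> K -> K -> 'M[K]_2) (h : K -> K -> 'M[K]_2).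

(** The coefficients do not depend on z, and equality is tested only where all
    these functions are meaningful. *)
Definition left_span e n h : Prop :=
  exists2 c : nat -> K -> 'M[K]_2, (forall j, regular_mx (c j)) &
    forall x z : K, x * (x - 2) != 0 -> z != 0 ->
      h x z = \sum_(j < n) c j x *m e j x z.

Lemma left_span0 e n : left_span e n (fun _ _ => 0).
Proof.
exists (fun _ _ => 0) => [j|x z _ _]; first exact: regular_mx_cst.
by rewrite big1 // => j _; rewrite mul0mx.
Qed.

Lemma left_spanD e n h h' :
  left_span e n h -> left_span e n h' ->
  left_span e n (fun x z => h x z + h' x z).
Proof.
move=> [c creg hE] [c' creg' hE'].
exists (fun j x => c j x + c' j x) => [j|x z x0 z0]; first exact: regular_mxD.
by rewrite hE // hE' // -big_split; apply: eq_bigr => j _; rewrite mulmxDl.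
Qed.

Lemma left_spanM e n h (A : K -> 'M[K]_2) :
  regular_mx A -> left_span e n h -> left_span e n (fun x z => A x *m h x z).
Proof.
move=> Areg [c creg hE].
exists (fun j x => A x *m c j x) => [j|x z x0 z0]; first exact: regular_mxM.
by rewrite hE // mulmx_sumr; apply: eq_bigr => j _; rewrite mulmxA.
Qed.

Lemma left_span_gen e n j : (j < n)%N -> left_span e n (e j).
Proof.
move=> jn; exists (fun k _ => (k == j)%:R%:M) => [k|x z _ _].
  exact: regular_mx_cst.
rewrite (bigD1 (Ordinal jn)) //= eqxx mul1mx big1 ?addr0 // => k kj.
by rewrite (negPf (_ : (k : nat) != j)) ?mul_scalar_mx ?scale0r //.
Qed.

Lemma eq_left_span e n h h' :
  (forall x z : K, x * (x - 2) != 0 -> z != 0 -> h x z = h' x z) ->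
  left_span e n h -> left_span e n h'.
Proof.
by move=> hh [c creg hE]; exists c => // x z x0 z0; rewrite -hh // hE.
Qed.

Lemma left_span_sum e n (I : Type) (r : seq I) (h : I -> K -> K -> 'M[K]_2) :
  (forall i, left_span e n (h i)) ->
  left_span e n (fun x z => \sum_(i <- r) h i x z).
Proof.
move=> hspan; elim: r => [|i r IH].
  by apply: eq_left_span (left_span0 e n) => x z _ _; rewrite big_nil.
by apply: eq_left_span (left_spanD (hspan i) IH) => x z _ _; rewrite big_cons.
Qed.

Lemma left_span_trans e e' n m h :
  (forall j, (j < n)%N -> left_span e' m (e j)) ->
  left_span e n h -> left_span e' m h.
Proof.
move=> ee' [c creg hE].
apply: (@eq_left_span _ _ (fun x z => \sum_(j < n) c j x *m e j x z)).
  by move=> x z x0 z0; rewrite hE.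
by apply: left_span_sum => j; apply: left_spanM (creg j) (ee' j (ltn_ord j)).
Qed.

Lemma left_span_leq e n m h : (n <= m)%N -> left_span e n h -> left_span e m h.
Proof.
move=> nm; apply: left_span_trans => j jn.
exact/left_span_gen/(leq_trans jn).
Qed.

(** Forward substitution: the system is triangular with identities on the
    diagonal. *)
Lemma left_span_triangular e e' :
  (forall n, exists2 r, left_span e n r & forall x z : K,
     x * (x - 2) != 0 -> z != 0 -> e' n x z = e n x z + r x z) ->
  forall n, left_span e' n.+1 (e n).
Proof.
move=> tri n; have [m] := ubnP n; elim: m n => // m IH n nm.
have [r rspan e'E] := tri n.
have r' : left_span e' n.+1 r.
  apply: left_span_trans rspan => j jn.
  by apply: (left_span_leq (leqW jn)); apply: IH; apply: leq_trans jn _.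
apply: eq_left_span (left_spanD (left_span_gen e' (ltnSn n))
  (left_spanM (regular_mx_cst (-1)%:M) r')) => x z x0 z0.
by rewrite e'E // mul_scalar_mx scaleN1r addrK.
Qed.
End LeftSpan.

(** * The derivatives of psi *)

Section Wave.
Variable R : realType.
Local Notation C := (Cplx R).

Definition expmode (j : nat) (x z : C) : 'M[C]_2 :=
  (expC (x * z) * z ^+ j.+1)%:M.

Lemma is_derive_expmode j (x z : C) :
  is_derive_mx ((expmode j)^~ z) x (expmode j.+1 x z).
Proof.
apply: is_derive_scalar_mx.
have dmul : is_derive x 1 (fun y : C => y * z) z.
  apply: (is_derive_eq (is_deriveM (is_derive_id x 1) (is_derive_cst z x 1))).
  by rewrite /GRing.scale /=; ring.
have dexp := is_derive_comp dmul (is_derive_expC _).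
apply: (is_derive_eq (is_deriveM dexp (is_derive_cst (z ^+ j.+1) x 1))).
by rewrite /GRing.scale /= [in RHS]exprS; ring.
Qed.

Lemma psiE (x z : C) : x * (x - 2) != 0 -> z != 0 ->
  psi R x z = (expC (x * z) / z ^+ 2) *: (dress x).[z%:M].
Proof.
move=> /nonsingularP[x0 x2] z0.
rewrite dress_horner mulmxE !mx22_scalar /dress1 /dress0 /psi.
rewrite !mx22Z mx22M !mx22D !mx22Z.
have {}x2 : x - 2 != 0 by rewrite subr_eq0.
by congr mx22; field; rewrite ?x0 ?z0 ?x2.
Qed.

(** The equation psi' = A1 psi + z e^(xz), the form in which d^3 = (d - A1) P is
    used. *)
Lemma is_derive_psi (x z : C) : x * (x - 2) != 0 -> z != 0 ->
  is_derive_mx ((psi R)^~ z) x (dress1 x *m psi R x z + expmode 0 x z).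
Proof.
(* z^-2 is split as z z^-3 to reuse the derivative of z e^(xz) *)
move=> x02 z0; pose F (y : C) : 'M[C]_2 :=
  (expC (y * z) * z ^+ 1)%:M *m
    ((z ^- 3)%:M *m ((z ^+ 2)%:M + z%:M *m dress1 y + dress0 y)).
have FE (y : C) : y * (y - 2) != 0 -> F y = psi R y z.
  move=> y02; rewrite psiE // dress_horner /F mulmxA -scalar_mxM mul_scalar_mx.
  by congr (_ *: _); field.
apply: (near_eq_is_derive_mx (A := F)).
  by apply: filterS (near_nonsingular x02) => y /FE.
have dcst (A : 'M[C]_2) := is_derive_mx_cst A x.
have dD := is_derive_mxM (is_derive_expmode 0 x z)
  (is_derive_mxM (dcst (z ^- 3)%:M)
   (is_derive_mxD (is_derive_mxD (dcst (z ^+ 2)%:M)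
      (is_derive_mxM (dcst z%:M) (is_derive_dress1 x02)))
      (is_derive_dress0 x02))).
apply: is_derive_mx_eq dD _.
rewrite -FE // /F /expmode !mul0mx !add0r !mul_scalar_mx.
rewrite -!scalemxAr !mulmxDr -!scalemxAr mul_mx_scalar.
exact: dress_wave_identity.
Qed.

(** One of the two families of generators; [dpsi] is the other. *)
Definition wave (j : nat) : C -> C -> 'M[C]_2 :=
  if j is i.+1 then expmode i else psi R.

Definition dpsi (i : nat) (x z : C) : 'M[C]_2 :=
  mx_derive1n i ((psi R)^~ z) x.

(** What the derivative of a wave has besides the next wave. *)
Definition wave_carry (j : nat) (x z : C) : 'M[C]_2 :=
  if j is 0%N then dress1 x *m psi R x z else 0.

Lemma left_span_carry j n : left_span wave n.+1 (wave_carry j).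
Proof.
case: j => [|j]; last exact: left_span0.
exact: (@left_spanM C wave n.+1 (wave 0) (@dress1 C) (@regular_dress1 C)
          (left_span_gen wave (ltn0Sn n))).
Qed.

Lemma is_derive_wave j (x z : C) : x * (x - 2) != 0 -> z != 0 ->
  is_derive_mx ((wave j)^~ z) x
    (wave j.+1 x z + wave_carry j x z).
Proof.
case: j => [|j] x0 z0 /=; first by rewrite addrC; exact: is_derive_psi.
by rewrite addr0; exact: is_derive_expmode.
Qed.

Lemma left_span_derive n h : left_span wave n h ->
  exists2 dh, left_span wave n.+1 dh & forall x z : C,
    x * (x - 2) != 0 -> z != 0 -> is_derive_mx (h^~ z) x (dh x z).
Proof.
move=> [c creg hE].
have /choice[dc dcP] : forall j, exists dA : C -> 'M[C]_2, regular_mx dA /\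
    forall x : C, x * (x - 2) != 0 -> is_derive_mx (c j) x (dA x).
  by move=> j; have [dA] := regular_mx_derive (creg j); exists dA.
exists (fun x z => \sum_(j < n) (dc j x *m wave j x z +
   c j x *m (wave j.+1 x z + wave_carry j x z))).
  apply: left_span_sum => j; apply: left_spanD.
    have [dcreg _] := dcP j; apply: left_spanM dcreg _.
    by apply: left_span_gen; rewrite ltnS ltnW.
  apply: left_spanM (creg j) _; apply: left_spanD.
    by apply: left_span_gen; rewrite ltnS.
  exact: left_span_carry.
move=> x z x0 z0; apply: (near_eq_is_derive_mx
  (A := fun y => \sum_(j < n) c j y *m wave j y z)).
  by apply: filterS (near_nonsingular x0) => y y0; rewrite hE.
apply: is_derive_mx_sum => j; apply: is_derive_mxM.
  by have [_] := dcP j; apply.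
exact: is_derive_wave.
Qed.

(** The derivative of a wave is the next wave, up to A1 psi in the case of psi;
    so the n-th derivative of psi starts with wave n, with coefficient 1. *)
Lemma dpsi_wave n : exists2 r, left_span wave n r & forall x z : C,
  x * (x - 2) != 0 -> z != 0 -> dpsi n x z = wave n x z + r x z.
Proof.
elim: n => [|n [r rspan rE]].
  exists (fun _ _ => 0) => [|x z _ _]; first exact: left_span0.
  by rewrite addr0; apply/matrixP => i j; rewrite mxE.
have [dr drspan drE] := left_span_derive rspan.
exists (fun x z => wave_carry n x z + dr x z) => [|x z x0 z0].
  by apply: left_spanD drspan; exact: left_span_carry.
rewrite addrA; apply: mx_derive1n_derive.
apply: (near_eq_is_derive_mx (A := fun y => wave n y z + r y z)).
  by apply: filterS (near_nonsingular x0) => y y0; rewrite -rE.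
by apply: is_derive_mxD; [exact: is_derive_wave|exact: drE].
Qed.

Lemma left_span_dpsi n : left_span wave n.+1 (dpsi n).
Proof.
have [r rspan dE] := dpsi_wave n.
apply: (@eq_left_span _ _ _ (fun x z => wave n x z + r x z)).
  by move=> x z x0 z0; rewrite dE.
apply: left_spanD; first exact: left_span_gen.
exact: left_span_leq rspan.
Qed.

Lemma left_span_wave n : left_span dpsi n.+1 (wave n).
Proof. by apply: left_span_triangular => m; exact: dpsi_wave. Qed.

(** Division by z^-2 e^(xz) turns identities between waves into identities
    between polynomials, to which all waves but psi contribute multiples of
    z^3. *)
Lemma wave_psi_factor (x z : C) (n : nat) (L : 'M[C]_2) (b : nat -> 'M[C]_2) :
  x * (x - 2) != 0 -> z != 0 ->
  L *m psi R x z + \sum_(j < n) b j *m expmode j x z =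
  (expC (x * z) / z ^+ 2) *:
    (L%:P * dress x + (\poly_(j < n) b j) * 'X^3).[z%:M].
Proof.
move=> x0 z0; rewrite hornerD 2!hornerM_scalar hornerC scalerDr psiE //.
rewrite scalemxAr; congr (_ + _).
rewrite (hornerZM _ (size_poly _ _)) hornerXn expr_scalar_mx.
rewrite mulmx_suml scaler_sumr; apply: eq_bigr => j _.
rewrite coef_poly ltn_ord /expmode !mul_mx_scalar.
rewrite !scalerA; congr (_ *: _).
by rewrite exprS [z ^+ 3]exprS; field.
Qed.

End Wave.

(** * Meromorphic coefficients and the disc *)

Lemma near_dnbhs_neq (K : numFieldType) (x0 c : K) :
  \forall x \near x0^', x != c.
Proof.
have [<-|xc] := eqVneq x0 c; first exact: nbhs_dnbhs_neq.
exact/nbhs_dnbhs/near_neq.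
Qed.

Lemma dnbhs_join (K : numFieldType) (x0 : K) (P : K -> Prop) :
  (\forall x \near x0^', P x) -> \forall x \near x0^', \forall y \near x, P y.
Proof.
rewrite !near_withinE => /near_join nP; near=> x => xx0.
have nPx : \forall y \near x, y != x0 -> P y by near: x; exact: nP.
by apply: filterS (filterI nPx (near_neq xx0)) => y [Py yx0]; exact: Py.
Unshelve. all: by end_near. Qed.

(** Poles are isolated, and so are the points where the values of f are
    irrelevant. *)
Lemma meromorphic_near_holomorphic (K : numFieldType) (f : K -> K) (x0 : K) :
  meromorphic_at f x0 -> \forall x \near x0^', holomorphic_at f x.
Proof.
move=> [n [g [ghol fg]]]; apply: dnbhs_join.
near=> x.
have fgx : \forall y \near x, (y - x0) ^+ n * f y = g y.
  by near: x; exact: dnbhs_join.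
have dg : derivable g x 1 by near: x; exact: nbhs_dnbhs.
have xx0 : x != x0 by near: x; exact: near_dnbhs_neq.
pose q : {poly K} := ('X - x0%:P) ^+ n.
have qE (y : K) : q.[y] = (y - x0) ^+ n by rewrite horner_exp hornerXsubC.
have qx0 : q.[x] != 0 by rewrite qE expf_neq0 // subr_eq0.
have fh : \forall y \near x, (g * (fun y => q.[y]^-1)) y = f y.
  apply: filterS (filterI fgx (near_neq xx0)) => y [fgy yx0] /=.
  have q0 : (y - x0) ^+ n != 0 by rewrite expf_neq0 // subr_eq0.
  by rewrite mulrfctE qE -fgy mulrAC mulfV // mul1r.
have dV := is_deriveV qx0 (is_derive_horner q x).
have dh := is_deriveM (derivableP dg) dV.
by apply: near_eq_derivable fh _; case: dh.
Unshelve. all: by end_near. Qed.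

Lemma regular_holomorphic_point (K : numFieldType) m n (U : set K) (l : nat)
    (a : 'I_l.+1 -> K -> 'M[K]_(m, n)) :
  open U -> U !=set0 -> (forall i, mx_meromorphic_on U (a i)) ->
  exists x : K,
    [/\ U x, x * (x - 2) != 0 & forall i, mx_holomorphic_at (a i) x].
Proof.
move=> openU [x0 Ux0] amero.
have nU : \forall x \near x0^', U x by apply: nbhs_dnbhs; exact: open_nbhs_nbhs.
have nhol : \forall x \near x0^', forall i, mx_holomorphic_at (a i) x.
  apply: filter_forall => i; apply: filter_forall => j.
  apply: filter_forall => k.
  exact/meromorphic_near_holomorphic/amero.
have : \forall x \near x0^',
    [/\ U x, x * (x - 2) != 0 & forall i, mx_holomorphic_at (a i) x].
  near=> x; split; first by near: x.
    by apply/nonsingularP; split; near: x; exact: near_dnbhs_neq.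
  by near: x.
exact: filter_ex.
Unshelve. all: by end_near. Qed.

Lemma norm_real_complex (R : realType) (t : R) : `|t%:C%C : Cplx R| = `|t|%:C%C.
Proof. by rewrite normc_def /= expr0n addr0 sqrtr_sqr. Qed.

(** A disc is the union of the segments that join its centre to its points. *)
Lemma connected_ball (R : realType) (c r : Cplx R) :
  0 < r -> connected (ball c r).
Proof.
move=> r0.
pose seg (w : Cplx R) (t : R) : Cplx R := c + t%:C%C * (w - c).
have -> : ball c r = \bigcup_(w in ball c r) (seg w @` `[0, 1]).
  apply/seteqP; split=> [w cw|_ [w cw] [t /= t01 <-]].
    exists w => //; exists 1 => /=; first by rewrite in_itv /= ler01 lexx.
    by rewrite /seg rmorph1 mul1r addrC subrK.
  move: t01; rewrite in_itv /= => /andP[t0 t1].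
  rewrite -ball_normE /ball_ /= /seg opprD addrA subrr sub0r normrN normrM.
  rewrite norm_real_complex (ger0_norm t0).
  move: cw; rewrite -ball_normE /ball_ /= distrC; apply: le_lt_trans.
  by rewrite ler_piMl // lecR.
apply: bigcup_connected.
  exists c => w cw /=; exists 0; first by rewrite /= in_itv /= lexx ler01.
  by rewrite /seg rmorph0 mul0r addr0.
move=> w cw; apply: connected_continuous_connected.
  exact: segment_connected.
apply: continuous_subspaceT => t; apply: cvgD; first exact: cvg_cst.
apply: cvgMl; apply/cvgrPdist_lt => -[e e'].
rewrite (ltcE (0 : R[i])) /= => /andP[/eqP -> e0].
near=> s; rewrite -rmorphB norm_real_complex ltcR.
by near: s; apply: cvgr_dist_lt.
Unshelve. all: by end_near. Qed.

(** * The two inclusions *)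

Section Inclusions.
Variable R : realType.
Local Notation C := (Cplx R).

(** At a point x where all coefficients of L are holomorphic, L psi = psi F
    writes psi F as a combination of waves with constant coefficients, and
    cancelling e^(xz) leaves the congruence of N F and Lambda N modulo z^3. *)
Lemma bispectral_sub_Gamma : bispectral_algebra R `<=` Gamma R.
Proof.
move=> F [U [l [a [openU U0 _ amero LF]]]].
have [x [Ux x0 xhol]] := regular_holomorphic_point openU U0 amero.
(* freezing the coefficients at x leaves a combination of derivatives of psi *)
have aspan : left_span (wave (R := R)) l.+1
    (fun y z => \sum_(i < l.+1) a i x *m dpsi i y z).
  apply: left_span_sum => i.
  apply: (@left_spanM C _ _ (@dpsi R i) (fun _ => a i x)).
    exact: regular_mx_cst.
  exact: left_span_leq (ltn_ord i) (left_span_dpsi R i).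
have [c _ cE] := aspan.
have FE : dress x * F = (c 0 x)%:P * dress x + (\poly_(j < l) c j.+1 x) * 'X^3.
  apply: poly_mx_inj_off0 => z z0; rewrite hornerM_scalar.
  have e0 : expC (x * z) / z ^+ 2 != 0.
    by rewrite mulf_neq0 ?expC_neq0 // invr_neq0 // expf_neq0.
  apply: (scalerI e0); rewrite -wave_psi_factor // scalemxAl -psiE //.
  have [x1 x2] := (nonsingularP _).1 x0.
  rewrite -LF // [LHS](cE x z x0 z0) big_ord_recl.
  by congr (_ + _).
have lowE k : (k < 3)%N -> (dress x * F)`_k = ((c 0 x)%:P * dress x)`_k.
  by move=> k3; rewrite FE coefD coefMXn k3 addr0.
have [M0 M1 M2] := coef_dressM x F.
have [D0 D1 D2 _] := coef_Cdress x (c 0 x).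
apply/GammaP; apply: (dress_intertwining_necessary (L := c 0 x) x0).
- exact: etrans (esym M0) (etrans (lowE 0 isT) D0).
- exact: etrans (esym M1) (etrans (lowE 1 isT) D1).
- exact: etrans (esym (M2 0)) (etrans (lowE 2 isT) D2).
Qed.

(** The matrix Lambda is L x below.  The quotient of N F - Lambda N by z^3 has
    coefficients V j, read off from N F because Lambda N has degree 2. *)
Lemma Gamma_sub_bispectral : Gamma R `<=` bispectral_algebra R.
Proof.
move=> F /GammaP[a [b [c [d [e [F0 F1 F2]]]]]].
pose L (x : C) := F`_0 + dress1 x *m F`_1 + dress0 x *m F`_2.
pose V j (x : C) := F`_j.+1 + dress1 x *m F`_j.+2 + dress0 x *m F`_j.+3.
have regD k : regular_mx (fun x : C =>
    F`_k + dress1 x *m F`_k.+1 + dress0 x *m F`_k.+2).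
  apply: regular_mxD; [apply: regular_mxD|].
  - exact: regular_mx_cst.
  - by apply: regular_mxM; [exact: regular_dress1|exact: regular_mx_cst].
  - by apply: regular_mxM; [exact: regular_dress0|exact: regular_mx_cst].
pose n := size F.
have FE (x : C) : x * (x - 2) != 0 ->
    dress x * F = (L x)%:P * dress x + (\poly_(j < n) V j x) * 'X^3.
  move=> x0; have [M0 M1 M2] := coef_dressM x F.
  have [D0 D1 D2 D3] := coef_Cdress x (L x).
  have [] := dress_intertwining_sufficient a b c d e x0.
  rewrite -F0 -F1 -F2 => I0 I1.
  apply/polyP => -[|[|[|k]]]; rewrite coefD coefMXn /= ?addr0.
  - exact: etrans M0 (etrans I0 (esym D0)).
  - exact: etrans M1 (etrans I1 (esym D1)).
  - exact: etrans (M2 0) (esym D2).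
  apply: etrans (M2 k.+1) _; rewrite [X in _ = X + _](D3 k) add0r coef_poly.
  rewrite !subSS subn0; case: ltnP => // nk.
  have nk2 := leqW (leqW nk).
  by rewrite !nth_default ?mulr0 ?addr0 ?leqW ?nk2.
have Fspan : left_span (wave (R := R)) n.+1 (fun x z => psi R x z *m F.[z%:M]).
  exists (fun j => if j is i.+1 then V i else L) => [[|j]|x z x0 z0];
    [exact: (regD 0)|exact: regD|].
  rewrite big_ord_recl; symmetry.
  apply: etrans (wave_psi_factor n (L x) (fun j => V j x) x0 z0) _.
  by rewrite -FE // hornerM_scalar scalemxAl -psiE.
have [op opreg opE] : left_span (dpsi (R := R)) n.+1
    (fun x z => psi R x z *m F.[z%:M]).
  apply: left_span_trans Fspan => j jn.
  exact: left_span_leq jn (left_span_wave R j).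
have ball12 (x : C) : ball (1 : C) 1 x -> x * (x - 2) != 0.
  rewrite -ball_normE /ball_ /= => x1; apply/nonsingularP; split.
    by apply: contraTneq x1 => ->; rewrite subr0 normr1 ltxx.
  apply: contraTneq x1 => ->; have -> : 1 - 2 = -1 :> C by ring.
  by rewrite normrN1 ltxx.
exists (ball (1 : C) 1), n, (fun i => op i); split.
- exact: ball_open.
- by exists 1; apply: ballxx.
- exact: connected_ball.
- by move=> i x /ball12 x0 j k; apply: regular_meromorphic x0; exact: opreg.
- by move=> x z /ball12 x0 _ _ _ z0; rewrite opE.
Qed.

End Inclusions.

Theorem theorem8 (R : realType) : Gamma R = bispectral_algebra R.
Proof.
apply/seteqP; split; first exact: Gamma_sub_bispectral.
exact: bispectral_sub_Gamma.
Qed.
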